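(* There are no nontrivial finite-dimensional subshift algebras. That is, if $K$ is a field, $\mathsf X$ is a one-sided subshift over a finite or countable alphabet and the unital subshift algebra $\widetilde{\mathcal A}_K(\mathsf X)$ is nonzero, then $\widetilde{\mathcal A}_K(\mathsf X)$ is infinite-dimensional over $K$.
   Context: Let $\mathscr A$ be a finite or countable alphabet and $\mathsf X\subseteq\mathscr A^{\mathbb N}$ a one-sided subshift (a subset closed for the product of discrete topologies with $\sigma(\mathsf X)\subseteq\mathsf X$), with shift $\sigma(x_0x_1x_2\cdots)=x_1x_2\cdots$. Let $\mathcal L_{\mathsf X}$ be the set of finite words appearing in points of $\mathsf X$, including the empty word $\omega$. For $\alpha,\beta\in\mathcal L_{\mathsf X}$ put $C(\alpha,\beta)=\{\beta x\in\mathsf X:\alpha x\in\mathsf X\}$; for a letter $a$ put $Z_a=\{x\in\mathsf X:x_0=a\}=C(\omega,a)$ and $F_a=\{y\in\mathsf X: ay\in\mathsf X\}$. Let $\mathcal U$ be the Boolean algebra of subsets of $\mathsf X$ generated by all $C(\alpha,\beta)$, and $\widehat{\mathcal U}$ its Stone space of ultrafilters, with topology generated by the sets $O_A=\{\xi\in\widehat{\mathcal U}:A\in\xi\}$, $A\in\mathcal U$. Let $\operatorname{dom}(\widehat\sigma)=\bigcup_{a\in\mathscr A}O_{Z_a}$ and, for $\xi\in O_{Z_a}$, let $\widehat\sigma(\xi)=\{B\in\mathcal U:\{y\in Z_a:\sigma(y)\in B\}\in\xi\}$; this is a local homeomorphism $\operatorname{dom}(\widehat\sigma)\to\widehat{\mathcal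 U}$, mapping $O_{Z_a}$ homeomorphically onto $O_{F_a}$. For a local homeomorphism $\tau:\operatorname{dom}(\tau)\to Y$ with $\operatorname{dom}(\tau)$ open in a totally disconnected locally compact Hausdorff space $Y$ (iterates having their natural domains, $\tau^0=\mathrm{id}_Y$), the Deaconu--Renault groupoid is $G(Y,\tau)=\{(x,k,y)\in Y\times\mathbb Z\times Y:\exists\,m,n\ge0,\ k=m-n,\ x\in\operatorname{dom}(\tau^m),\ y\in\operatorname{dom}(\tau^n),\ \tau^m(x)=\tau^n(y)\}$ with $r(x,k,y)=x$, $s(x,k,y)=y$, $(x,k,y)(y,\ell,z)=(x,k+\ell,z)$, $(x,k,y)^{-1}=(y,-k,x)$ and topology generated by the sets $\{(x,m-n,y):x\in U,y\in V,\tau^m(x)=\tau^n(y)\}$ with $U\subseteq\operatorname{dom}(\tau^m)$, $V\subseteq\operatorname{dom}(\tau^n)$ open and $\tau^m|_U,\tau^n|_V$ homeomorphisms onto their images. It is an ample Hausdorff groupoid, and its Steinberg algebra is $A_K(G(Y,\tau))=\mathrm{span}_K\{1_U:U\text{ a compact open bisection}\}$ with convolution product, $1_U*1_V=1_{UV}$ (a bisection is a set on which $r$ and $s$ are injective). The unital subshift algebra is $\widetilde{\mathcal A}_K(\mathsf X):=A_K(G(\widehat{\mathcal U},\widehat\sigma))$. *)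

(* Defs.v *)
From HB Require Import structures.
From mathcomp Require Import all_boot all_order all_algebra.
From mathcomp Require Import all_classical topology numfun.

Set Implicit Arguments.
Unset Strict Implicit.
Unset Printing Implicit Defensive.

Import GRing.Theory.
Local Open Scope classical_set_scope.
Local Open Scope ring_scope.

Section Sequences.
Variable A : Type.

Definition shift (x : nat -> A) : nat -> A := fun n => x n.+1.

Definition prepend (w : seq A) (x : nat -> A) : nat -> A :=
  fun n => nth (x (n - size w)%N) w n.

Lemma prepend0 x : prepend [::] x = x.
Proof. by apply/funext => n; rewrite /prepend nth_nil subn0. Qed.

Lemma shift_prepend a w x : shift (prepend (a :: w) x) = prepend w x.
Proof. by apply/funext => n; rewrite /shift /prepend /= subSS. Qed.

Lemma prepend_shift y : prepend [:: y 0%N] (shift y) = y.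
Proof. by apply/funext => -[|n] //; rewrite /prepend /= nth_nil subn1. Qed.

Lemma prepend_cons a w x :
  prepend (a :: w) x = prepend [:: a] (prepend w x).
Proof.
apply/funext => -[|n] //.
by rewrite /prepend /= nth_nil subSS subn1.
Qed.

End Sequences.
Arguments shift {A}.
Arguments prepend {A}.

Record subshift (A : countType) := Subshift {
  points : set (nat -> A);
  subshift_closed : closed (points : set {ptws nat -> discrete_topology A});
  subshift_shift : shift @` points `<=` points }.

(* The members of M need not be subsets of X, but this is automatic for the
   smallest such M containing a given family of subsets of X. *)
Definition set_algebra_on (T : Type) (X : set T) (M : set (set T)) :=
  [/\ M set0, M X, setI_closed M, setU_closed M &
      forall B, M B -> M (X `\` B)].

Section SubshiftBooleanAlgebra.
Variables (A : countType) (S : subshift A).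
Local Notation X := (points S).

(* [::] is put in by hand: it belongs to the language even when X is empty. *)
Definition language : set (seq A) :=
  [set w | w = [::] \/
    exists x i, X x /\ w = mkseq (fun j => x (i + j)%N) (size w)].

Definition cyl (a b : seq A) : set (nat -> A) :=
  prepend b @` [set x | X (prepend b x) /\ X (prepend a x)].

Definition Zcyl (a : A) : set (nat -> A) := [set x | X x /\ x 0%N = a].

Definition balg : set (set (nat -> A)) :=
  smallest (set_algebra_on X) [set cyl a b | a in language & b in language].

Definition balg_proper_filter (xi : set (set (nat -> A))) :=
  [/\ xi `<=` balg, xi X, ~ xi set0, setI_closed xi &
      forall B C, xi B -> balg C -> B `<=` C -> xi C].

Definition balg_ultrafilter (xi : set (set (nat -> A))) :=
  balg_proper_filter xi /\
  forall eta, balg_proper_filter eta -> xi `<=` eta -> eta = xi.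

Lemma balg_algebra : set_algebra_on X balg.
Proof.
split.
- by move=> M [[]].
- by move=> M [[]].
- by move=> B C UB UC M HM; have [_ _ + _ _] := HM.1;
    apply; [exact: UB|exact: UC].
- by move=> B C UB UC M HM; have [_ _ _ + _] := HM.1;
    apply; [exact: UB|exact: UC].
- by move=> B UB M HM; have [_ _ _ _ +] := HM.1; apply; exact: UB.
Qed.

Lemma balg_cyl a b : language a -> language b -> balg (cyl a b).
Proof. by move=> La Lb; apply: sub_gen_smallest; exists a => //; exists b. Qed.

Lemma balg_sub B : balg B -> B `<=` X.
Proof.
move=> UB; apply: (UB [set B | B `<=` X]); split; last first.
  by move=> _ [a _ [b _ <-]] _ [x [Xb _] <-].
split => //.
- by move=> C D CX _ x [/CX].
- by move=> C D CX DX x [/CX|/DX].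
- by move=> C _ x [].
Qed.

Lemma language_cons a b x : X (prepend (a :: b) x) -> language (a :: b).
Proof.
move=> Xx; right; exists (prepend (a :: b) x), 0%N; split => //.
apply: (@eq_from_nth _ a); first by rewrite size_mkseq.
move=> i ilt; rewrite nth_mkseq // add0n /prepend.
exact: set_nth_default.
Qed.

Lemma ZcylE a : Zcyl a = cyl [::] [:: a].
Proof.
apply/seteqP; split=> y.
  move=> [Xy <-]; exists (shift y); last exact: prepend_shift.
  by split; rewrite ?prepend_shift ?prepend0//; apply: subshift_shift; exists y.
by move=> [x [Xx _] <-].
Qed.

Lemma balg_Zcyl a : balg (Zcyl a).
Proof.
have [U0 _ _ _ _] := balg_algebra.
rewrite ZcylE; have [La|nL] := pselect (language [:: a]).
  by apply: balg_cyl => //; left.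
rewrite (_ : cyl _ _ = set0) //; apply/seteqP; split => // y.
by move=> [x [Xx _] _]; apply: nL; exact: language_cons Xx.
Qed.

Lemma preimage_complE a B :
  Zcyl a `&` shift @^-1` (X `\` B)
  = Zcyl a `&` (X `\` (Zcyl a `&` shift @^-1` B)).
Proof.
apply/seteqP; split=> y /= [Zy].
  by move=> [_ nB]; split => //; split; [exact: Zy.1|move=> []].
move=> [_ nB]; split => //; split; last by move=> By; apply: nB.
by apply: subshift_shift; exists y => //; exact: Zy.1.
Qed.

Lemma balg_preimage a B : balg B -> balg (Zcyl a `&` shift @^-1` B).
Proof.
have [U0 UX UI UU UC] := balg_algebra.
move=> UB; apply: (UB [set B | balg (Zcyl a `&` shift @^-1` B)]).
split; first split => /=.
- by rewrite preimage_set0 setI0.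
- rewrite (_ : _ `&` _ = Zcyl a); first exact: balg_Zcyl.
  apply: setIidl => y [Xy _].
  by apply: subshift_shift; exists y.
- move=> C D HC HD /=.
  rewrite (_ : _ `&` _ =
    (Zcyl a `&` shift @^-1` C) `&` (Zcyl a `&` shift @^-1` D)).
    exact: UI.
  by rewrite preimage_setI setIACA setIid.
- by move=> C D HC HD /=; rewrite preimage_setU setIUr; exact: UU.
- move=> C HC /=; rewrite preimage_complE; apply: UI; first exact: balg_Zcyl.
  exact: UC.
move=> _ [b Lb [c _ <-]] /=.
have E : Zcyl a `&` shift @^-1` cyl b c = cyl b (a :: c).
  apply/seteqP; split=> y.
    move=> [[Xy ya] [x [_ Xb] xy]]; exists x.
      by split; rewrite // prepend_cons xy -ya prepend_shift.
    by rewrite prepend_cons xy -ya prepend_shift.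
  move=> [x [Xac Xb] <-]; split => //=; exists x; last by rewrite shift_prepend.
  split => //; rewrite -(shift_prepend a); apply: subshift_shift.
  by exists (prepend (a :: c) x).
rewrite E; have [La|nL] := pselect (language (a :: c)); first exact: balg_cyl.
rewrite (_ : cyl _ _ = set0) //; apply/seteqP; split => // y.
by move=> [x [Xx _] _]; apply: nL; exact: language_cons Xx.
Qed.

Lemma balg_ultra_setC xi B : balg_ultrafilter xi -> balg B ->
  ~ xi B -> xi (X `\` B).
Proof.
move=> [[xU xX x0 xI xS] xmax] UB nB.
have [U0 UX UI UU UC] := balg_algebra.
apply: contrapT => nC; apply: nB.
pose eta := [set C | balg C /\ exists2 D, xi D & D `&` B `<=` C].
suff -> : xi = eta by split => //; exists X => //; exact: subIsetr.
apply/esym/xmax; last first.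
  by move=> C xC; split; [exact: xU|exists C => //; exact: subIsetl].
split.
- by move=> C [].
- split => //; exists X => //; exact: subIsetl.
- move=> [_ [D xD D0]]; apply: nC; apply: (xS D) => //; first exact: UC.
  move=> x Dx; split; first exact: (balg_sub (xU _ xD)).
  by move=> Bx; exact: (D0 x).
- move=> C1 C2 [U1 [D1 x1 s1]] [U2 [D2 x2 s2]]; split; first exact: UI.
  exists (D1 `&` D2); first exact: xI.
  by move=> x [[? ?] ?]; split; [exact: s1|exact: s2].
- move=> C1 C2 [_ [D xD DC]] U2 C12; split => //; exists D => //.
  exact: subset_trans C12.
Qed.

Definition shift_ultra (a : A) (xi : set (set (nat -> A))) :
    set (set (nat -> A)) :=
  [set B | balg B /\ xi (Zcyl a `&` shift @^-1` B)].

Lemma shift_ultraP a xi : balg_ultrafilter xi -> xi (Zcyl a) ->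
  balg_ultrafilter (shift_ultra a xi).
Proof.
move=> ux xa; have [[xU xX x0 xI xS] _] := ux.
have [U0 UX UI UU UC] := balg_algebra.
split; first split.
- by move=> B [].
- split => //; rewrite (_ : _ `&` _ = Zcyl a) //.
  by apply: setIidl => y [Xy _]; apply: subshift_shift; exists y.
- by move=> [_]; rewrite preimage_set0 setI0.
- move=> B C [UB xB] [UC' xC]; split; first exact: UI.
  rewrite (_ : _ `&` _ =
    (Zcyl a `&` shift @^-1` B) `&` (Zcyl a `&` shift @^-1` C)).
    exact: xI.
  by rewrite preimage_setI setIACA setIid.
- move=> B C [UB xB] UC' BC; split => //; apply: (xS _ _ xB).
    exact: balg_preimage.
  by apply: setIS => y; exact: BC.
move=> eta [eU _ e0 eI _] sub; apply/seteqP; split => // B eB.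
have UB := eU _ eB.
split => //; apply: contrapT => nB.
have xC := balg_ultra_setC ux (balg_preimage a UB) nB.
apply: e0; rewrite -(setDIK B X); apply: eI => //; apply: sub.
split; first exact: UC.
by rewrite preimage_complE; exact: xI.
Qed.

Record stone := Stone {
  ultra : set (set (nat -> A));
  ultraP : balg_ultrafilter ultra }.

HB.instance Definition _ := gen_eqMixin stone.
HB.instance Definition _ := gen_choiceMixin stone.

Definition stone_open (B : set (nat -> A)) : set stone := [set xi | ultra xi B].

HB.instance Definition _ :=
  @isSubBaseTopological.Build stone (set (nat -> A)) balg stone_open.

Definition sigma_dom : set stone := \bigcup_(a in [set: A]) stone_open (Zcyl a).

(* sigma_hat is the identity outside sigma_dom; this value is never used. *)
Definition sigma_hat (xi : stone) : stone :=
  match pselect (exists a, stone_open (Zcyl a) xi) with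
  | left h => let (a, ha) := cid h in Stone (shift_ultraP (ultraP xi) ha)
  | right _ => xi
  end.

Lemma sigma_hatE a (xi : stone) : stone_open (Zcyl a) xi ->
  ultra (sigma_hat xi) = shift_ultra a (ultra xi).
Proof.
move=> xa; rewrite /sigma_hat; case: pselect; last by case; exists a.
move=> h; case: cid => b xb /=.
have [[_ _ x0 xI _] _] := ultraP xi.
suff -> : b = a by [].
apply: contrapT => ba; apply: x0; rewrite (_ : set0 = Zcyl a `&` Zcyl b).
  exact: xI.
by apply/esym/seteqP; split => // y [[_ ya] [_ yb]]; apply: ba; rewrite -ya -yb.
Qed.

End SubshiftBooleanAlgebra.

Section DeaconuRenault.
(* The partial map is given by its domain D and a total function tau, whose
   values outside D are never used. *)
Variables (Y : topologicalType) (D : set Y) (tau : Y -> Y).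

Fixpoint iter_dom (m : nat) : set Y :=
  if m is m'.+1 then D `&` tau @^-1` iter_dom m' else setT.

Definition dr_rel (x : Y) (k : int) (y : Y) :=
  exists m n : nat, [/\ k = m%:Z - n%:Z, iter_dom m x, iter_dom n y &
                        iter m tau x = iter n tau y].

Record drgpd := DRGpd {
  rng : Y;
  deg : int;
  src : Y;
  drgpdP : dr_rel rng deg src }.

HB.instance Definition _ := gen_eqMixin drgpd.
HB.instance Definition _ := gen_choiceMixin drgpd.

Definition homeo_onto_image (U : set Y) (f : Y -> Y) :=
  {within U, continuous f} /\
  exists g : Y -> Y, {in U, cancel f g} /\ {within f @` U, continuous g}.

Definition dr_basic (m n : nat) (U V : set Y) : set drgpd :=
  [set g | [/\ U (rng g), V (src g), deg g = m%:Z - n%:Z &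
               iter m tau (rng g) = iter n tau (src g)]].

Definition dr_basis : set (set drgpd) :=
  [set W | exists m n U V,
    [/\ W = dr_basic m n U V,
        open U /\ U `<=` iter_dom m, open V /\ V `<=` iter_dom n,
        homeo_onto_image U (iter m tau) & homeo_onto_image V (iter n tau)]].

HB.instance Definition _ :=
  @isSubBaseTopological.Build drgpd (set drgpd) dr_basis id.

(* dr_mul a b c : the pair (a, b) is composable and c = ab. *)
Definition dr_mul (a b c : drgpd) :=
  [/\ src a = rng b, rng c = rng a, src c = src b & deg c = deg a + deg b].

Definition bisection (U : set drgpd) := set_inj U rng /\ set_inj U src.

Definition compact_open_bisection (U : set drgpd) :=
  [/\ compact U, open U & bisection U].

Definition dr_setM (U V : set drgpd) : set drgpd :=
  [set c | exists a b, [/\ U a, V b & dr_mul a b c]].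

End DeaconuRenault.

Section Steinberg.
Variables (K : fieldType) (Y : topologicalType) (D : set Y) (tau : Y -> Y).
Local Notation G := (drgpd D tau).

Definition steinberg_pred : {pred G -> K^o} := fun f =>
  `[< exists n (c : 'I_n -> K) (U : 'I_n -> set G),
        (forall i, compact_open_bisection (U i)) /\
        f = \sum_(i < n) c i *: (\1_(U i) : G -> K^o) >].

Lemma steinberg_submod : submod_closed steinberg_pred.
Proof.
split.
  apply/asboolP; exists 0%N, (fun=> 0), (fun=> set0); split; first by case.
  by rewrite big_ord0.
move=> k f g /asboolP[m [c [U [HU ->]]]] /asboolP[n [d [V [HV ->]]]].
apply/asboolP; exists (m + n)%N.
exists (fun i : 'I_(m + n) => match fintype.split i with inl j => k * c j | inr j => d j end).
exists (fun i : 'I_(m + n) => match fintype.split i with inl j => U j | inr j => V j end).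
split; first by move=> i; case: fintype.split.
rewrite big_split_ord /= scaler_sumr; congr (_ + _).
  by apply: eq_bigr => i _; rewrite (unsplitK (inl i)) scalerA.
by apply: eq_bigr => i _; rewrite (unsplitK (inr i)).
Qed.

HB.instance Definition _ :=
  GRing.isSubmodClosed.Build K (G -> K^o) steinberg_pred steinberg_submod.

Record steinberg := Steinberg {
  steinberg_fun :> G -> K^o;
  steinbergP : steinberg_fun \in steinberg_pred }.

HB.instance Definition _ := [isSub for steinberg_fun].
HB.instance Definition _ := [Choice of steinberg by <:].
HB.instance Definition _ := [SubChoice_isSubLmodule of steinberg by <:].

(* The convolution product of the Steinberg algebra. Dimension over K only
   involves the K-module structure above. *)
Definition convolution (f g : G -> K) : G -> K := fun c =>
  \sum_(p \in [set p : G * G | dr_mul p.1 p.2 c]) f p.1 * g p.2.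

Lemma convolution_indic (U V : set G) : bisection U -> bisection V ->
  convolution \1_U \1_V = \1_(dr_setM U V).
Proof.
move=> [Ur _] [_ Vs]; apply/funext => c; rewrite /convolution [in RHS]/indic.
have [|nc] := pselect (dr_setM U V c); last first.
  rewrite [c \in _](introF idP) ?inE // fsbig1 // => -[a b] /= abc.
  rewrite /indic; have [/set_mem Ua|_] := boolP (a \in U); last by rewrite mul0r.
  have [/set_mem Vb|_] := boolP (b \in V); last by rewrite mulr0.
  by case: nc; exists a, b.
move=> [a [b [Ua Vb abc]]]; rewrite mem_set; last by exists a, b.
transitivity (\sum_(p \in [set (a, b)]) (\1_U p.1 * \1_V p.2 : K)).
  apply/esym/fsbig_widen; first by move=> _ ->.
  move=> [a' b'] /= [abc' nab]; rewrite /indic.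
  have [/set_mem Ua'|_] := boolP (a' \in U); last by rewrite mul0r.
  have [/set_mem Vb'|_] := boolP (b' \in V); last by rewrite mulr0.
  case: nab; case: abc' abc => _ rc' sc' _ [_ rc sc _].
  have -> : a' = a by apply: Ur; rewrite ?inE // -rc' -rc.
  by have -> : b' = b by apply: Vs; rewrite ?inE // -sc' -sc.
by rewrite fsbig_set1 /indic /= !mem_set // mulr1.
Qed.

End Steinberg.

Definition finite_dimensional (K : fieldType) (V : lmodType K) :=
  exists n (b : 'I_n -> V), forall v, exists c : 'I_n -> K,
    v = \sum_(i < n) c i *: b i.

Definition subshift_algebra (K : fieldType) (A : countType) (X : subshift A) :
    lmodType K :=
  steinberg K (@sigma_dom A X) (@sigma_hat A X).

(* Main.v *)
Require Import Defs.
From mathcomp Require Import all_boot all_order all_algebra.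
From mathcomp Require Import all_classical topology numfun.

Set Implicit Arguments.
Unset Strict Implicit.
Unset Printing Implicit Defensive.

Import GRing.Theory.
Local Open Scope classical_set_scope.
Local Open Scope ring_scope.

(** The algebra is graded by the degree k of (x, k, y), and it is nonzero in
    every degree n >= 0; this already makes it infinite-dimensional.

    A nonzero algebra needs a nonempty groupoid, hence an ultrafilter, hence a
    point x of X.  Let w be the prefix of length n of x and Z the set of points
    of X starting with w.  Then
    W = {(xi, n, sigma^n xi) : Z in xi}
    is a compact open bisection ([word_bisectionP]), and it is nonempty since
    the principal ultrafilter at x contains Z.  The bisections obtained for
    different n have different degrees, so they are pairwise disjoint, and
    their indicator functions are linearly independent
    ([steinberg_infinite]).

    The bisection property and openness both rest on the fact that sigma^n
    restricts to a homeomorphism from O_Z onto its image.  This in turn follows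
    from [word_transport]: on Z, every B in the Boolean algebra coincides with
    sigma^-n C for some C in the algebra.  So membership of B in xi can be read
    off from membership of C in sigma^n xi, which gives both the injectivity of
    sigma^n on O_Z and the continuity of its inverse.  Compactness of W is that
    of O_Z, i.e. of the Stone space: an ultrafilter F of sets of ultrafilters
    converges to {B : O_B in F}. *)

(** * Subbases and convergence of filters *)

Section Subbase.
Variables (T : topologicalType) (I : pointedType) (D : set I) (b : I -> set T).

(** Stated as an equation so that, for a topology constructed from the subbase,
    it holds by conversion. *)
Definition is_subbase :=
  @open T = [set \bigcup_(W in D') W | D' in subset^~ (finI_from D b)].

Lemma subbase_open i : is_subbase -> D i -> open (b i).
Proof.
move=> openE_subbase Di; rewrite openE_subbase.
exists [set b i]; last exact: bigcup_set1.
by move=> _ ->; exact: finI_from1.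
Qed.

Lemma subbase_cvg (F : set_system T) (x : T) : is_subbase -> Filter F ->
  (forall i, D i -> b i x -> F (b i)) -> F --> x.
Proof.
move=> openE_subbase FF Fb W; rewrite nbhsE => -[O [oO Ox] OW].
apply: filterS OW _.
move: oO; rewrite openE_subbase => -[D' D'f OE]; move: Ox; rewrite -OE.
move=> [V D'V Vx]; apply: (@filterS _ _ _ V); first by move=> y Vy; exists V.
have [E ED VE] := D'f _ D'V; move: Vx; rewrite -VE => Vx.
apply: filter_bigI => i iE; apply: Fb; last exact: Vx.
by have /set_mem := ED _ iE.
Qed.

End Subbase.

Lemma ultra_fmap (T T' : Type) (f : T -> T') (F : set_system T) :
  UltraFilter F -> UltraFilter (f @ F).
Proof.
move=> FU; split; first exact: fmap_proper_filter.
move=> H HP FH; apply/seteqP; split => // V HV.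
have [//|FnV] := in_ultra_setVsetC (f @^-1` V) FU.
have HFF : Filter H by exact: filter_filter.
case: (@filter_not_empty _ H _); rewrite -(setICr V).
by apply: filterI => //; exact: FH.
Qed.

(** * The Stone space of the Boolean algebra *)

Section Stone.
Variables (A : countType) (S : subshift A).
Local Notation X := (points S).
Local Notation U := (balg S).
Local Notation stoneS := (stone S).

Lemma stone_subbase : @is_subbase stoneS _ U (@stone_open A S).
Proof. by []. Qed.

Lemma stone_openP B : U B -> open (stone_open B : set stoneS).
Proof. exact: (subbase_open stone_subbase). Qed.

Lemma stone_ext (xi eta : stoneS) :
  (forall B, U B -> ultra xi B <-> ultra eta B) -> xi = eta.
Proof.
case: xi eta => [x xP] [y yP] /= xy.
have xyE : x = y.
  apply/seteqP; split => B HB.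
    by apply/xy => //; case: xP => -[xU _ _ _ _] _; exact: xU.
  by apply/xy => //; case: yP => -[yU _ _ _ _] _; exact: yU.
by move: xP yP; rewrite xyE => xP yP; congr Stone; exact: Prop_irrelevance.
Qed.

(** A proper filter that decides every member of the algebra is maximal: an
    extension containing some undesired B would also contain its complement. *)
Lemma ultrafilter_of_setC (xi : set (set (nat -> A))) :
  balg_proper_filter S xi ->
  (forall B, U B -> xi B \/ xi (X `\` B)) -> balg_ultrafilter S xi.
Proof.
move=> xP xC; split => // eta [eU _ e0 eI _] xe; apply/seteqP; split => // B eB.
have [//|xCB] := xC _ (eU _ eB).
case: e0; rewrite -(setDIK B X); apply: eI => //; exact: xe.
Qed.

Lemma point_ultrafilter x : X x -> balg_ultrafilter S [set B | U B /\ B x].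
Proof.
move=> Xx; have [U0 UX UI UU UC] := balg_algebra S.
apply: ultrafilter_of_setC.
  split.
  - by move=> B [].
  - by split.
  - by case.
  - by move=> B C [? ?] [? ?]; split; [exact: UI|split].
  - by move=> B C [_ Bx] UC' BC; split => //; exact: BC.
move=> B UB; have [Bx|nBx] := pselect (B x); [by left|right].
by split; [exact: UC|].
Qed.

(** An ultrafilter F of subsets of the Stone space that contains O_B converges
    to the point {C : O_C in F}, which is decisive because O sends complements
    to complements, and which lies in O_B. *)
Lemma stone_open_compact B : U B -> compact (stone_open B : set stoneS).
Proof.
have [U0 UX UI UU UC] := balg_algebra S.
move=> UB; rewrite compact_ultra => F FU FB.
have xP : balg_ultrafilter S [set C | U C /\ F (stone_open C)].
  apply: ultrafilter_of_setC.
    split.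
    - by move=> C [].
    - split => //; rewrite (_ : stone_open X = setT); first exact: filterT.
      by apply/seteqP; split => // xi _; have [[_ ? _ _ _] _] := ultraP xi.
    - move=> [_]; rewrite (_ : stone_open set0 = set0).
        exact: filter_not_empty.
      by apply/seteqP; split => // xi; have [[_ _ ? _ _] _] := ultraP xi.
    - move=> C D [UC' FC] [UD FD]; split; first exact: UI.
      apply: filterS (filterI FC FD) => xi [].
      by have [[_ _ _ + _] _] := ultraP xi; apply.
    - move=> C D [UC' FC] UD CD; split => //; apply: filterS FC => xi xC.
      by have [[_ _ _ _ +] _] := ultraP xi; apply; first exact: xC.
  move=> C UC'; have [FC|FnC] := in_ultra_setVsetC (stone_open C) FU.
    by left.
  right; split; first exact: UC.
  apply: filterS FnC => xi xnC; exact: (balg_ultra_setC (ultraP xi)).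
exists (Stone xP); split; first by split.
by apply: (subbase_cvg stone_subbase) => C UC' [].
Qed.

End Stone.

(** * Words and iterates of the shift *)

Section Cylinder.
Variables (A : countType) (S : subshift A).
Local Notation X := (points S).
Local Notation U := (balg S).
Local Notation sigma := (@sigma_hat A S).
Local Notation dom := (@sigma_dom A S).

(** The points of X that start with w, in a recursive form that matches one
    application of the shift at a time. *)
Fixpoint word_cyl (w : seq A) : set (nat -> A) :=
  if w is a :: v then Zcyl S a `&` shift @^-1` word_cyl v else X.

Lemma word_cyl_consI a w B :
  word_cyl (a :: w) `&` iter (size w).+1 shift @^-1` B =
  Zcyl S a `&` shift @^-1` (word_cyl w `&` iter (size w) shift @^-1` B).
Proof.
rewrite preimage_setI setIA; apply/seteqP.
by split => y [yw]; rewrite /preimage /= -iterS iterSr.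
Qed.

Lemma balg_word_preimage w B :
  U B -> U (word_cyl w `&` iter (size w) shift @^-1` B).
Proof.
move=> UB; elim: w => [|a w IHw].
  by rewrite /= setIidr //; exact: balg_sub.
by rewrite word_cyl_consI; exact: balg_preimage.
Qed.

Lemma balg_word_cyl w : U (word_cyl w).
Proof.
elim: w => [|a w IHw] /=; first by have [_ ? _ _ _] := balg_algebra S.
exact: balg_preimage.
Qed.

Lemma word_cyl_prefix n x : X x -> exists2 w, size w = n & word_cyl w x.
Proof.
elim: n x => [|n IHn] x Xx; first by exists [::].
have Xsx : X (shift x) by apply: subshift_shift; exists x.
by have [w <- wx] := IHn _ Xsx; exists (x 0%N :: w).
Qed.

Lemma prepend_cat (u v : seq A) x :
  prepend (u ++ v) x = prepend u (prepend v x).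
Proof.
elim: u => [|a u IHu]; first by rewrite prepend0.
by rewrite cat_cons prepend_cons IHu -prepend_cons.
Qed.

Lemma language_prepend w x : X (prepend w x) -> language S w.
Proof. by case: w => [|a w]; [left|exact: language_cons]. Qed.

(** The sets B with this property form a Boolean algebra, since taking
    preimages commutes with the set operations; so it suffices to treat the
    generators C(al, be).  When be starts with a, delete that letter; when be
    starts with another letter, the intersection is empty; when be is empty,
    append a to al. *)
Lemma letter_transport a B : U B ->
  exists2 C, U C & Zcyl S a `&` B = Zcyl S a `&` shift @^-1` C.
Proof.
have [U0 UX UI UU UC] := balg_algebra S.
pose M := [set B | exists2 C, U C &
  Zcyl S a `&` B = Zcyl S a `&` shift @^-1` C].
have Xs y : X y -> X (shift y) by move=> Xy; apply: subshift_shift; exists y.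
move=> UB; apply: (UB M); split; first split.
- by exists set0.
- exists X => //; apply/seteqP; split => y [Zy Xy]; split => //.
    exact: Xs.
  by case: Zy.
- move=> B1 B2 [C1 U1 E1] [C2 U2 E2]; exists (C1 `&` C2); first exact: UI.
  by rewrite preimage_setI setIIr E1 E2 -setIIr.
- move=> B1 B2 [C1 U1 E1] [C2 U2 E2]; exists (C1 `|` C2); first exact: UU.
  by rewrite preimage_setU !setIUr E1 E2.
- move=> B1 [C1 U1 E1]; exists (X `\` C1); first exact: UC.
  by rewrite preimage_complE -E1; apply/seteqP; split => y [Zy [Xy nB]];
    split => //; split => // By; apply: nB => //; case: By.
move=> _ [al Lal [be Lbe <-]].
have [E0|/set0P[y [[Xy ya] [x [Xbe Xal] xy]]]] :=
  eqVneq (Zcyl S a `&` cyl S al be) set0.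
  by exists set0; rewrite // E0 preimage_set0 setI0.
case: be Lbe Xbe xy => [|b be] Lbe Xbe xy.
  have alE z : z 0%N = a -> prepend (al ++ [:: a]) (shift z) = prepend al z.
    by move=> za; rewrite prepend_cat -za prepend_shift.
  exists (cyl S (al ++ [:: a]) [::]).
    apply: balg_cyl; last by left.
    apply: (@language_prepend _ (shift y)).
    by rewrite alE // -xy prepend0.
  apply/seteqP; split => z [[Xz za]].
    move=> [t [Xt Xat] tz]; split => //; exists (shift z); last first.
      by rewrite prepend0.
    by split; rewrite ?prepend0; [exact: Xs|rewrite alE // -tz prepend0].
  move=> [t [Xt Xat] tz]; split => //; exists z; last by rewrite prepend0.
  by split; rewrite ?prepend0 // -(alE z za) -tz prepend0.
have ba : b = a by rewrite -ya -xy.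
subst b.
exists (cyl S al be).
  apply: balg_cyl => //; apply: (@language_prepend _ x).
  by rewrite -(shift_prepend a); exact: Xs.
apply/seteqP; split => z [[Xz za]].
  move=> [t [Xt Xat] tz]; split => //; exists t.
    by split => //; rewrite -(shift_prepend a); exact: Xs.
  by rewrite -tz shift_prepend.
move=> [t [Xt Xat] tz]; split => //.
have zE : prepend (a :: be) t = z.
  by rewrite prepend_cons tz -za prepend_shift.
by exists t => //; split => //; rewrite zE.
Qed.

(** By induction on w, one letter at a time.  This is what makes the iterated
    shift invertible on the ultrafilters that contain the cylinder of w. *)
Lemma word_transport w B : U B -> exists2 C, U C &
  word_cyl w `&` B = word_cyl w `&` iter (size w) shift @^-1` C.
Proof.
elim: w B => [|a w IHw] B UB; first by exists B.
have [C1 UC1 E1] := letter_transport a UB.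
have [C UC E2] := IHw _ UC1.
exists C => //; rewrite word_cyl_consI -E2 /= setIAC E1 preimage_setI.
by rewrite setIAC setIA.
Qed.

(** Reads off the iterates of the map on ultrafilters from preimages in X, so
    that the rest of the argument can ignore how the map is defined. *)
Lemma sigma_hat_iter w (xi : stone S) : stone_open (word_cyl w) xi ->
  iter_dom dom sigma (size w) xi /\
  forall B, U B -> ultra (iter (size w) sigma xi) B <->
    ultra xi (word_cyl w `&` iter (size w) shift @^-1` B).
Proof.
elim: w xi => [|a w IHw] xi xw.
  split => // B UB; rewrite /= setIidr //; exact: balg_sub.
have [[xU _ _ _ xS] _] := ultraP xi.
have xa : stone_open (Zcyl S a) xi.
  exact: (xS _ _ xw (balg_Zcyl _) (@subIsetl _ _ _)).
have sE := sigma_hatE xa.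
have sw : stone_open (word_cyl w) (sigma xi).
  by rewrite /stone_open /= sE; split => //; exact: balg_word_cyl.
have [sd sP] := IHw _ sw; split.
  by split => //; exists a.
move=> B UB; rewrite [size _]/= iterSr sP // sE word_cyl_consI.
by split => [[]//|xB]; split => //; exact: balg_word_preimage.
Qed.

End Cylinder.

(** * A compact open bisection of each degree *)

Section Bisection.
Variables (A : countType) (S : subshift A).
Local Notation U := (balg S).
Local Notation sigma := (@sigma_hat A S).
Local Notation dom := (@sigma_dom A S).
Local Notation G := (drgpd dom sigma).
Variable w : seq A.
Local Notation n := (size w).
Local Notation Ow := (stone_open (word_cyl S w) : set (stone S)).

Lemma drgpd_subbase : @is_subbase G _ (@dr_basis _ dom sigma) id.
Proof. by []. Qed.

Lemma drgpd_ext (g h : G) :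
  rng g = rng h -> src g = src h -> deg g = deg h -> g = h.
Proof.
case: g h => [r k s P] [r' k' s' P'] /= rE sE kE; subst.
by congr DRGpd; exact: Prop_irrelevance.
Qed.

Lemma stone_open_setI B C (xi : stone S) : U B -> U C ->
  stone_open (B `&` C) xi <-> stone_open B xi /\ stone_open C xi.
Proof.
move=> UB UC; have [[_ _ _ xI xS] _] := ultraP xi.
split => [xBC|[xB xC]]; last exact: xI.
by split; [exact: (xS _ _ xBC UB (@subIsetl _ _ _))
          |exact: (xS _ _ xBC UC (@subIsetr _ _ _))].
Qed.

(** Membership of B in xi can be tested on sigma^n xi; this single fact gives
    the injectivity of sigma^n on O_Z and the continuity of its inverse, where
    Z is the cylinder of w and n the length of w. *)
Lemma ultra_transport B : U B -> exists2 C, U C &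
  forall xi, Ow xi -> ultra xi B <-> ultra (iter n sigma xi) C.
Proof.
move=> UB; have [C UC E] := word_transport w UB; exists C => // xi xw.
have [_ sP] := sigma_hat_iter xw.
rewrite sP // -E -[ultra xi (_ `&` _)]/(stone_open (_ `&` _) xi).
rewrite stone_open_setI //; last exact: balg_word_cyl.
by split => [|[]].
Qed.

Lemma sigma_hat_iter_inj xi eta :
  Ow xi -> Ow eta -> iter n sigma xi = iter n sigma eta -> xi = eta.
Proof.
move=> xw ew E; apply: stone_ext => B UB.
by have [C _ CE] := ultra_transport UB; rewrite !CE // E.
Qed.

Lemma sigma_hat_iter_within : {within Ow, continuous (iter n sigma)}.
Proof.
apply/subspace_continuousP => xi xw.
apply: (subbase_cvg (@stone_subbase A S)) => B UB xB.
have UB' := balg_word_preimage w UB.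
have [_ sP] := sigma_hat_iter xw.
have : nbhs xi (stone_open (word_cyl S w `&` iter n shift @^-1` B)
                : set (stone S)).
  by apply: open_nbhs_nbhs; split; [exact: stone_openP|apply/sP].
apply: filterS => eta eB ew; have [_ tP] := sigma_hat_iter ew.
exact/tP.
Qed.

Lemma sigma_hat_iter_homeo : homeo_onto_image Ow (iter n sigma).
Proof.
split; first exact: sigma_hat_iter_within.
have [g gP] : exists g, forall xi, Ow xi -> g (iter n sigma xi) = xi.
  have /choice[g gP] : forall eta, exists zeta,
      forall xi, Ow xi -> iter n sigma xi = eta -> zeta = xi.
    move=> eta; have [[xi xw xE]|no] := pselect ((iter n sigma @` Ow) eta).
      exists xi => xi' xw' xE'; apply: sigma_hat_iter_inj => //.
      by rewrite xE xE'.
    by exists eta => xi xw xE; case: no; exists xi.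
  by exists g => xi xw; exact: gP.
exists g; split; first by move=> xi /set_mem; exact: gP.
apply/subspace_continuousP => _ [xi xw <-].
apply: (subbase_cvg (@stone_subbase A S)) => B UB.
rewrite /from_subspace gP // => xB.
have [C UC CE] := ultra_transport UB.
have : nbhs (iter n sigma xi) (stone_open C : set (stone S)).
  by apply: open_nbhs_nbhs; split; [exact: stone_openP|apply/CE].
apply: filterS => eta eC [zeta zw zE]; move: eC; rewrite /= -zE gP //.
by move=> zC; exact/CE.
Qed.

(** The set {(xi, n, sigma^n xi) : Z in xi}, with Z the cylinder of w. *)
Definition word_bisection : set G := dr_basic n 0 Ow setT.

Lemma word_bisection_point xi : Ow xi ->
  exists2 g : G, word_bisection g & rng g = xi.
Proof.
move=> xw; have [sd _] := sigma_hat_iter xw.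
have r : dr_rel dom sigma xi n (iter n sigma xi).
  by exists n, 0%N; split => //; rewrite subr0.
by exists (DRGpd r); split => //=; rewrite subr0.
Qed.

Lemma word_bisection_deg g : word_bisection g -> deg g = n.
Proof. by move=> [_ _ ->]; rewrite subr0. Qed.

Lemma word_bisection_rng_inj : set_inj word_bisection (@rng _ dom sigma).
Proof.
move=> g h /set_mem[_ _ gk gE] /set_mem[_ _ hk hE] rE; apply: drgpd_ext => //.
  by move: gE hE => /= <- <-; rewrite rE.
by rewrite gk hk.
Qed.

Lemma word_bisection_src_inj : set_inj word_bisection (@src _ dom sigma).
Proof.
move=> g h gW hW sE; apply: word_bisection_rng_inj => //.
move: gW hW => /set_mem[gw _ _ gE] /set_mem[hw _ _ hE].
by apply: sigma_hat_iter_inj => //; rewrite gE hE /= sE.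
Qed.

Lemma open_word_bisection : open word_bisection.
Proof.
apply: (subbase_open drgpd_subbase (i := word_bisection)).
exists n, 0%N, Ow, setT; split => //.
- split; first exact: stone_openP (balg_word_cyl _).
  by move=> xi xw; case: (sigma_hat_iter xw).
- by split => //; exact: openT.
- exact: sigma_hat_iter_homeo.
split; first by apply: continuous_subspaceT => x; exact: cvg_id.
exists id; split => //.
by apply: continuous_subspaceT => x; exact: cvg_id.
Qed.

(** The range map is a homeomorphism from the bisection to the compact set O_Z,
    where Z is the cylinder of w.  Concretely, an ultrafilter on the
    bisection is pushed to O_Z by the range map; its image converges there to
    some xi, and the ultrafilter itself converges to (xi, n, sigma^n xi) by
    continuity of sigma^n. *)
Lemma compact_word_bisection : compact word_bisection.
Proof.
rewrite compact_ultra => F FU FW.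
have := stone_open_compact (@balg_word_cyl _ S w); rewrite compact_ultra.
have FOw : F (@rng _ dom sigma @^-1` Ow) by apply: filterS FW => g [].
move=> /(_ (@rng _ dom sigma @ F) (ultra_fmap _ FU) FOw)[xi [xw Fxi]].
have [g gW gxi] := word_bisection_point xw.
exists g; split => //; apply: (subbase_cvg drgpd_subbase).
move=> _ [k [l [V1 [V2 [-> [oV1 V1d] [oV2 V2d] h1 h2]]]]] [gV1 gV2 gk gE].
have := word_bisection_deg gW; rewrite gk => klE.
have FV1 : F (@rng _ dom sigma @^-1` V1).
  by apply: Fxi; apply: open_nbhs_nbhs; split => //; rewrite -gxi.
have FV2 : F (@rng _ dom sigma @^-1`
              [set eta | Ow eta -> V2 (iter n sigma eta)]).
  have /subspace_continuousP/(_ _ xw) := sigma_hat_iter_within.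
  move=> /(_ V2) H; apply: Fxi; apply: H.
  apply: open_nbhs_nbhs; split => //.
  by case: gW => _ _ _; rewrite gxi /= /from_subspace => ->.
apply: filterS (filterI FW (filterI FV1 FV2)) => h [hW [hV1 hV2]].
have hd := word_bisection_deg hW; case: hW => hw _ _ /= hE.
have V2s : V2 (src h) by rewrite -hE; exact: hV2.
(* k = l + n, so the condition sigma^k xi = sigma^l (sigma^n xi) is vacuous. *)
have -> : k = (l + n)%N.
  by apply/eqP; rewrite -eqz_nat PoszD addrC -klE subrK.
split => //; first by rewrite hd PoszD addrAC subrr add0r.
by rewrite iterD hE.
Qed.

Lemma word_bisectionP : compact_open_bisection word_bisection.
Proof.
split; [exact: compact_word_bisection|exact: open_word_bisection|].
by split; [exact: word_bisection_rng_inj|exact: word_bisection_src_inj].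
Qed.

End Bisection.

(** * Linear independence in the Steinberg algebra *)

Section Steinberg.
Variables (K : fieldType) (Y : topologicalType) (D : set Y) (tau : Y -> Y).
Local Notation G := (drgpd D tau).
Local Notation AK := (steinberg K D tau).

Lemma steinberg_indic_subproof (W : set G) : compact_open_bisection W ->
  (\1_W : G -> K^o) \in @steinberg_pred K Y D tau.
Proof.
move=> WP; apply/asboolP; exists 1%N, (fun=> 1), (fun=> W); split => //.
by rewrite big_ord1 scale1r.
Qed.

Definition steinberg_indic (W : set G) (WP : compact_open_bisection W) : AK :=
  Steinberg (steinberg_indic_subproof WP).

Lemma steinberg_sumE n (c : 'I_n -> K) (f : 'I_n -> AK) (g : G) :
  (\sum_(i < n) c i *: f i : AK) g = \sum_(i < n) c i * f i g.
Proof.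
rewrite -[steinberg_fun _]/(val _) raddf_sum fct_sumE.
by apply: eq_bigr.
Qed.

(** Choose a point g k in each W k.  If n elements b j spanned, evaluating the
    indicators of W 0, ..., W n at g 0, ..., g n would factor the identity
    matrix of size n + 1 through dimension n. *)
Lemma steinberg_infinite (W : nat -> set G) :
  (forall n, compact_open_bisection (W n)) -> (forall n, W n !=set0) ->
  trivIset setT W -> ~ finite_dimensional AK.
Proof.
move=> WP Wn0 Wtriv [n [b bP]].
have [g gW] := choice Wn0.
have [c cE] := choice (fun i : 'I_n.+1 => bP (steinberg_indic (WP i))).
pose C := \matrix_(i < n.+1, j < n) c i j.
pose B := \matrix_(j < n, k < n.+1) (b j (g k) : K).
suff /mulmx1_min : C *m B = 1%:M by rewrite ltnn.
apply/matrixP => i k; rewrite !mxE.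
transitivity (steinberg_indic (WP i) (g k)).
  by rewrite cE steinberg_sumE; apply: eq_bigr => j _; rewrite !mxE.
rewrite /= /indic; have [->|ik] := eqVneq i k; first by rewrite mem_set.
rewrite memNset // => gW'; move/eqP: ik; apply; apply/val_inj.
by apply: Wtriv => //; exists (g k); split.
Qed.

End Steinberg.

Theorem proposition6p18 (K : fieldType) (A : countType) (X : subshift A) :
  (exists f : subshift_algebra K X, f != 0) ->
  ~ finite_dimensional (subshift_algebra K X).
Proof.
move=> [f f0].
have [g] : inhabited (drgpd (@sigma_dom A X) (@sigma_hat A X)).
  apply: contrapT => noG; move/eqP: f0; apply; apply: val_inj.
  by apply/funext => g; case: noG.
have [x Xx] : points X !=set0.
  apply/set0P/eqP => X0.
  by have [[_ + + _ _] _] := ultraP (rng g); rewrite X0.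
have /choice[w wP] n : exists w, size w = n /\ word_cyl X w x.
  by have [w wn wx] := word_cyl_prefix n Xx; exists w.
apply: (@steinberg_infinite K _ _ _ (fun n => @word_bisection A X (w n))).
- by move=> n; exact: word_bisectionP.
- move=> n; have [_ wx] := wP n.
  have : stone_open (word_cyl X (w n)) (Stone (point_ultrafilter Xx)).
    by split => //; exact: balg_word_cyl.
  by move=> /word_bisection_point[h hW _]; exists h.
move=> m n _ _ [h [/word_bisection_deg hm /word_bisection_deg hn]].
have [<- _] := wP m; have [<- _] := wP n.
by apply/eqP; rewrite -eqz_nat -hm -hn.
Qed.
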